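(* Let $\mathscr{F}\subseteq\mathscr{P}(\omega)$ be an $\omega$-closed family. Then the following conditions are equivalent: (i) $\boldsymbol{B}_{\mathbb{Z}}^{\mathscr{F}}$ is a bisimple semigroup; (ii) $\mathscr{F}$ is a one-element family; (iii) the semigroup $\boldsymbol{B}_{\mathbb{Z}}^{\mathscr{F}}$ is either trivial or isomorphic to the extended bicyclic semigroup.
   Context: $\omega$ is the set of non-negative integers and $\mathscr{P}(\omega)$ is the family of all its subsets. For $n\in\mathbb{Z}$ and $A\subseteq\mathbb{Z}$ put $n+A=\{n+a: a\in A\}$ (so $n+\varnothing=\varnothing$). A family $\mathscr{F}\subseteq\mathscr{P}(\omega)$ is $\omega$-closed if $F_1\cap(-n+F_2)\in\mathscr{F}$ for all $n\in\omega$ and $F_1,F_2\in\mathscr{F}$. For an $\omega$-closed family $\mathscr{F}$, the set $\mathbb{Z}\times\mathbb{Z}\times\mathscr{F}$ carries the associative operation $$(i_1,j_1,F_1)\cdot(i_2,j_2,F_2)=\begin{cases}(i_1-j_1+i_2,\;j_2,\;(j_1-i_2+F_1)\cap F_2), & j_1<i_2;\\ (i_1,\;j_2,\;F_1\cap F_2), & j_1=i_2;\\ (i_1,\;j_1-i_2+j_2,\;F_1\cap(i_2-j_1+F_2)), & j_1>i_2.\end{cases}$$ If $\varnothing\in\mathscr{F}$, then $\boldsymbol{I}=\{(i,j,\varnothing): i,j\in\mathbb{Z}\}$ is an ideal and $\boldsymbol{B}_{\mathbb{Z}}^{\mathscr{F}}$ is defined as the Rees quotient $(\mathbb{Z}\times\mathbb{Z}\times\mathscr{F},\cdot)/\boldsymbol{I}$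 ($\boldsymbol{I}$ is collapsed to one element, the zero); if $\varnothing\notin\mathscr{F}$, then $\boldsymbol{B}_{\mathbb{Z}}^{\mathscr{F}}=(\mathbb{Z}\times\mathbb{Z}\times\mathscr{F},\cdot)$. The extended bicyclic semigroup is $\boldsymbol{B}_{\mathbb{Z}}=\mathbb{Z}\times\mathbb{Z}$ with the operation $(i_1,j_1)\cdot(i_2,j_2)=(i_1+i_2-\min\{j_1,i_2\},\,j_1+j_2-\min\{j_1,i_2\})$. A semigroup is bisimple if it consists of a single $\mathscr{D}$-class (Green's relation $\mathscr{D}$); it is trivial if it has exactly one element. *)

(* Defs.v *)
From HB Require Import structures.
From mathcomp Require Import all_boot all_order all_algebra.
From mathcomp Require Import boolp classical_sets.
From mathcomp Require Import zify.

Set Implicit Arguments.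
Unset Strict Implicit.
Unset Printing Implicit Defensive.

Import Order.TTheory GRing.Theory Num.Theory.
Local Open Scope classical_set_scope.
Local Open Scope ring_scope.

Section SemigroupTheory.
Variable S : semigroupType.
Implicit Types (a b x y : S) (I : set S).

(* S^1 a and a S^1 *)
Definition principal_left_ideal a : set S :=
  [set a] `|` [set (x * a)%g | x in [set: S]].
Definition principal_right_ideal a : set S :=
  [set a] `|` [set (a * x)%g | x in [set: S]].

Definition greenL a b := principal_left_ideal a = principal_left_ideal b.
Definition greenR a b := principal_right_ideal a = principal_right_ideal b.
Definition greenD a b := exists c, greenL a c /\ greenR c b.

(* Asking for a class equal to [set: S] excludes the empty semigroup. *)
Definition bisimple := exists a, [set b | greenD a b] = [set: S].

Definition trivial_semigroup := exists a, [set: S] = [set a].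

Definition is_ideal I :=
  I !=set0 /\ forall a x, I a -> I (x * a)%g /\ I (a * x)%g.

End SemigroupTheory.

Arguments bisimple : clear implicits.
Arguments trivial_semigroup : clear implicits.

Definition semigroup_isomorphic (S T : semigroupType) :=
  exists f : {multiplicative S -> T}, bijective f.

Section ReesQuotient.
Variables (S : semigroupType) (I : set S) (idealI : is_ideal I).

Definition rees_rel (x y : S) : bool := `[< x = y \/ (I x /\ I y) >].

Fact rees_rel_refl : reflexive rees_rel.
Proof. by move=> x; apply/asboolP; left. Qed.

Fact rees_rel_sym : symmetric rees_rel.
Proof.
by move=> x y; apply/asboolP/asboolP => -[->|[? ?]]; [left|right|left|right].
Qed.

Fact rees_rel_trans : transitive rees_rel.
Proof.
move=> y x z /asboolP[->//|[Ix Iy]] /asboolP[<-|[_ Iz]]; apply/asboolP.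
  by right.
by right.
Qed.

Definition rees_equiv := EquivRel rees_rel rees_rel_refl rees_rel_sym
  rees_rel_trans.

(* The proof that I is an ideal is a phantom argument, so that the semigroup
   structure can be attached canonically to the type. *)
Definition rees_quotient of is_ideal I : Type := {eq_quot rees_equiv}%qT.
Local Notation Q := (rees_quotient idealI).

HB.instance Definition _ := Choice.on Q.
HB.instance Definition _ := EqQuotient.on Q.

Definition rees_mul (u v : Q) : Q := (\pi_Q (repr u * repr v)%g)%qT.

Lemma rees_mul_pi (x y : S) :
  rees_mul (\pi_Q x)%qT (\pi_Q y)%qT = (\pi_Q (x * y)%g)%qT.
Proof.
have H (z : S) : rees_rel (repr (\pi_Q z)%qT) z.
  by have /eqmodP := reprK (\pi_Q z)%qT.
rewrite /rees_mul; apply/eqmodP/asboolP.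
have /asboolP[->|[Ix' Ix]] := H x; last first.
  by right; split; [exact: (idealI.2 _ _ Ix').2 | exact: (idealI.2 _ _ Ix).2].
have /asboolP[->|[Iy' Iy]] := H y; first by left.
by right; split; [exact: (idealI.2 _ _ Iy').1 | exact: (idealI.2 _ _ Iy).1].
Qed.

Fact rees_mulA : associative rees_mul.
Proof.
move=> u v w; rewrite -[u]reprK -[v]reprK -[w]reprK.
move: (repr u) (repr v) (repr w) => x y z.
by rewrite (rees_mul_pi y z) (rees_mul_pi x y) !rees_mul_pi mulgA.
Qed.

HB.instance Definition _ := isSemigroup.Build Q rees_mulA.

End ReesQuotient.

Definition omega : set int := [set n | 0 <= n].

Definition shift (n : int) (A : set int) : set int := [set n + a | a in A].

Lemma shiftE n A z : shift n A z = A (z - n).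
Proof.
apply/propext; split=> [[a Aa <-]|Azn]; first by rewrite addrC addKr.
by exists (z - n) => //; rewrite addrC subrK.
Qed.

Definition omega_closed (F : set (set int)) :=
  forall n F1 F2, omega n -> F F1 -> F F2 -> F (F1 `&` shift (- n) F2).

Definition triple_mul (x y : int * int * set int) : int * int * set int :=
  let: (i1, j1, F1) := x in
  let: (i2, j2, F2) := y in
  if j1 < i2 then (i1 - j1 + i2, j2, shift (j1 - i2) F1 `&` F2)
  else if j1 == i2 then (i1, j2, F1 `&` F2)
  else (i1, j1 - i2 + j2, F1 `&` shift (i2 - j1) F2).

Lemma triple_mulA : associative triple_mul.
Proof.
have E (i j i' j' : int) (A B : set int) : i = i' -> j = j' ->
    (forall z, A z <-> B z) -> (i, j, A) = (i', j', B).
  by move=> -> -> AB; congr (_, _, _); apply/seteqP; split=> z /AB.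
have AE (A : set int) u v : A u -> u = v -> A v by move=> ? <-.
move=> [[i1 j1] F1] [[i2 j2] F2] [[i3 j3] F3] /=.
case: (ltgtP j1 i2) => ?; case: (ltgtP j2 i3) => ? /=.
all: do ?[case: ifP => ?].
all: try lia.
all: apply: E; try lia.
all: move=> z; rewrite /setI /= ?shiftE /= ?shiftE.
all: split; [move=> [? [? ?]] | move=> [[? ?] ?]]; do ?split.
all: by match goal with H : ?A _ |- ?A _ => apply: (AE _ _ _ H); lia end.
Qed.

Section ExtendedTriples.
Variables (F : set (set int)) (closedF : omega_closed F).

(* set_type F is the subtype of the members of F; the closure proof is again
   only a phantom argument. *)
Definition ZZfamily of omega_closed F : Type := (int * int * set_type F)%type.
Local Notation T := (ZZfamily closedF).

HB.instance Definition _ := Choice.on T.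

Definition triple_val (x : T) : int * int * set int :=
  (x.1.1, x.1.2, \val x.2).

Lemma triple_val_inj : injective triple_val.
Proof.
by move=> [[i j] A] [[i' j'] A'] [-> -> /val_inj ->].
Qed.

Fact triple_mul_closed (x y : T) :
  (triple_mul (triple_val x) (triple_val y)).2 \in F.
Proof.
case: x y => [[i1 j1] A1] [[i2 j2] A2]; rewrite /triple_val /=.
have FA1 : F (\val A1) by have := valP A1; rewrite inE.
have FA2 : F (\val A2) by have := valP A2; rewrite inE.
case: ltgtP => h /=; apply/mem_set.
- by rewrite setIC -opprB; apply: closedF => //; rewrite /omega /=; lia.
- by rewrite -opprB; apply: closedF => //; rewrite /omega /=; lia.
- have -> : \val A2 = shift (- 0) (\val A2).
    by apply/funext => z; rewrite shiftE subr0.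
  by apply: closedF => //; rewrite /omega /=.
Qed.

Definition ZZfamily_mul (x y : T) : T :=
  ((triple_mul (triple_val x) (triple_val y)).1,
   exist (fun A => A \in F) _ (triple_mul_closed x y)).

Lemma triple_valM (x y : T) :
  triple_val (ZZfamily_mul x y) = triple_mul (triple_val x) (triple_val y).
Proof.
have eta (u : int * int * set int) : (u.1.1, u.1.2, u.2) = u by case: u => [[]].
exact: eta.
Qed.

Fact ZZfamily_mulA : associative ZZfamily_mul.
Proof.
by move=> x y z; apply: triple_val_inj; rewrite !triple_valM triple_mulA.
Qed.

HB.instance Definition _ := isSemigroup.Build T ZZfamily_mulA.

Definition empty_triples : set T := [set x | \val x.2 = set0].

Lemma empty_triples_ideal : F set0 -> is_ideal empty_triples.
Proof.
move=> F0; split; first by exists (0, 0, exist (fun A => A \in F) _ (mem_set F0)).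
have sh0 n : shift n set0 = set0 by rewrite /shift image_set0.
move=> [[i j] A] [[k l] B] /=; rewrite /empty_triples /= => A0.
by rewrite /triple_val /= A0; split; case: ltgtP => _ /=;
  rewrite ?sh0 ?setI0 ?set0I.
Qed.

Definition BZfamily : semigroupType :=
  match pselect (F set0) with
  | left F0 => rees_quotient (empty_triples_ideal F0)
  | right _ => T
  end.

End ExtendedTriples.

Definition extended_bicyclic : Type := (int * int)%type.

HB.instance Definition _ := Choice.on extended_bicyclic.

Definition extended_bicyclic_mul (x y : extended_bicyclic) :
    extended_bicyclic :=
  (x.1 + y.1 - Num.min x.2 y.1, x.2 + y.2 - Num.min x.2 y.1).

Fact extended_bicyclic_mulA : associative extended_bicyclic_mul.
Proof.
move=> [i1 j1] [i2 j2] [i3 j3]; rewrite /extended_bicyclic_mul /=.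
by congr (_, _); lia.
Qed.

HB.instance Definition _ :=
  isSemigroup.Build extended_bicyclic extended_bicyclic_mulA.

(* Main.v *)
(** On triples, each of L and R preserves the third coordinate, hence so does D,
    so a bisimple semigroup of triples comes from a family with at most one
    member. In a Rees quotient the zero is alone in its L-class, so
    bisimplicity leaves only the zero. Conversely, if [F = [set A]], all third
    coordinates are [A], and forgetting them is an isomorphism from the triples
    onto the extended bicyclic semigroup; for [A = set0] the Rees quotient is
    trivial instead. Both semigroups are bisimple, which closes the cycle. *)

Require Import Defs.
From HB Require Import structures.
From mathcomp Require Import all_boot all_order all_algebra.
From mathcomp Require Import boolp classical_sets.
From mathcomp Require Import zify.
Local Open Scope classical_set_scope.

Import Order.TTheory GRing.Theory Num.Theory.
Local Open Scope ring_scope.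

(** * Green's relations and bisimplicity in an arbitrary semigroup *)

Section Green.
Variable S : semigroupType.
Implicit Types a b : S.

(** Each generator lies in its own principal ideal, and associativity lets inclusion of ideals be
    tested on generators. This turns [greenL] into mutual divisibility. *)
Lemma greenLP a b : greenL a b <->
  (a = b \/ exists x, a = (x * b)%g) /\ (b = a \/ exists x, b = (x * a)%g).
Proof.
have idealP c d : principal_left_ideal d c <-> c = d \/ exists x, c = (x * d)%g.
  by split=> [[->|[x _ <-]]|[->|[x ->]]];
    [left | right; exists x | left | right; exists x].
split=> [ab|[ab ba]].
  split; apply/idealP; first by rewrite -ab; left.
  by rewrite ab; left.
have incl c d : (c = d \/ exists x, c = (x * d)%g) ->
    principal_left_ideal c `<=` principal_left_ideal d.
  move=> [->//|[x ->]] z /idealP[->|[y ->]]; apply/idealP; right.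
    by exists x.
  by exists (y * x)%g; rewrite mulgA.
by apply/seteqP; split; apply: incl.
Qed.

Lemma greenRP a b : greenR a b <->
  (a = b \/ exists x, a = (b * x)%g) /\ (b = a \/ exists x, b = (a * x)%g).
Proof.
have idealP c d : principal_right_ideal d c <-> c = d \/ exists x, c = (d * x)%g.
  by split=> [[->|[x _ <-]]|[->|[x ->]]];
    [left | right; exists x | left | right; exists x].
split=> [ab|[ab ba]].
  split; apply/idealP; first by rewrite -ab; left.
  by rewrite ab; left.
have incl c d : (c = d \/ exists x, c = (d * x)%g) ->
    principal_right_ideal c `<=` principal_right_ideal d.
  move=> [->//|[x ->]] z /idealP[->|[y ->]]; apply/idealP; right.
    by exists x.
  by exists (x * y)%g; rewrite mulgA.
by apply/seteqP; split; apply: incl.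
Qed.

(** Since D is L followed by R, a function constant on L- and R-classes is constant on D-classes. *)
Lemma bisimple_invariant (X : Type) (f : S -> X) :
    (forall a b, greenL a b -> f a = f b) ->
    (forall a b, greenR a b -> f a = f b) ->
  bisimple S -> forall a b, f a = f b.
Proof.
move=> fL fR [c cS] a b.
have fD d : f c = f d.
  have : [set b | greenD c b] d by rewrite cS.
  by move=> [e [/fL-> /fR]].
by rewrite -!fD.
Qed.

Lemma bisimple_zero (z : S) :
    (forall x, (x * z)%g = z) -> (forall x, (z * x)%g = z) ->
  bisimple S -> forall a, a = z.
Proof.
(* The invariant is the proposition [a = z]: every multiple of [z] is [z], so L or R cannot relate
   [z] to another element. *)
move=> xz zx bS a; suff : (a = z) = (z = z) by move->.
apply: (bisimple_invariant _ (fun a => a = z) _ _ bS) => {}a b.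
  by move=> /greenLP[ab ba]; apply/propext; split=> e;
    [case: ba => [->|[x ->]] | case: ab => [->|[x ->]]]; rewrite e.
by move=> /greenRP[ab ba]; apply/propext; split=> e;
  [case: ba => [->|[x ->]] | case: ab => [->|[x ->]]]; rewrite e.
Qed.

Lemma trivial_bisimple : trivial_semigroup S -> bisimple S.
Proof.
move=> [a Sa]; exists a; rewrite Sa; apply/seteqP; split=> b.
  by move=> _; have : [set: S] b by []; rewrite Sa.
by move=> ->; exists a.
Qed.

End Green.

(** The inverse bijection is also multiplicative, so it carries divisibility witnesses from [T] back
    to [S]. *)
Lemma bisimple_isomorphic (S T : semigroupType) :
  semigroup_isomorphic S T -> bisimple T -> bisimple S.
Proof.
move=> [f [g fK gK]] [t tT]; exists (g t); apply/seteqP; split=> // b _.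
have gM x y : g (x * y)%g = (g x * g y)%g.
  by rewrite -[RHS]fK gmulfM !gK.
have : [set b | greenD t b] (f b) by rewrite tT.
move=> [c [/greenLP[tc ct] /greenRP[cb bc]]]; exists (g c); split.
  apply/greenLP; split.
    by case: tc => [->|[x ->]]; [left | right; exists (g x)].
  by case: ct => [->|[x ->]]; [left | right; exists (g x)].
rewrite -[b]fK; apply/greenRP; split.
  by case: cb => [->|[x ->]]; [left | right; exists (g x)].
by case: bc => [->|[x ->]]; [left | right; exists (g x)].
Qed.

Lemma extended_bicyclic_bisimple : bisimple extended_bicyclic.
Proof.
pose p i j : extended_bicyclic := (i, j).
(* As with matrix units: equal second coordinates give L, equal first coordinates give R, so [p k 0]
   links [p 0 0] to [p k l]. *)
have E i j k : p i k = (p i j * p j k)%g.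
  by congr (_, _) => /=; lia.
exists (p 0 0); apply/seteqP; split=> // -[k l] _; exists (p k 0); split.
  by apply/greenLP; split; right; eexists; apply: E.
by apply/greenRP; split; right; eexists; apply: E.
Qed.

(** * Bisimplicity of the triples and of their Rees quotient *)

Section Triples.
Variables (F : set (set int)) (closedF : omega_closed F).
Local Notation T := (ZZfamily closedF).

Lemma ZZfamily_member (x : T) : F (\val x.2).
Proof. by have := valP x.2; rewrite inE. Qed.

Lemma triple_val_mulg (x y : T) :
  triple_val (x * y)%g = triple_mul (triple_val x) (triple_val y).
Proof. exact: triple_valM. Qed.

Lemma eq_memP (A : set int) u v : u = v -> A u -> A v.
Proof. by move=> ->. Qed.

(* These bounds reverse when the two triples are swapped, so on L- and
   R-classes the index and the member of the family are both fixed. *)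
Lemma mulg_left_bound (x y : T) :
  y.1.2 <= (x * y)%g.1.2 /\
  \val (x * y)%g.2 `<=` shift (y.1.2 - (x * y)%g.1.2) (\val y.2).
Proof.
move: (triple_val_mulg x y); rewrite /triple_val.
case: (x * y)%g => [[i j] A]; case: x => [[i1 j1] A1]; case: y => [[i2 j2] A2] /=.
(* In all three cases the right-hand set of the intersection is [A2] shifted by [j2 - j]. *)
by case: ltgtP => h [_ -> ->]; split; try lia; move=> z [? Az];
  rewrite ?shiftE in Az *; apply: eq_memP Az; lia.
Qed.

Lemma mulg_right_bound (x y : T) :
  x.1.1 <= (x * y)%g.1.1 /\
  \val (x * y)%g.2 `<=` shift (x.1.1 - (x * y)%g.1.1) (\val x.2).
Proof.
move: (triple_val_mulg x y); rewrite /triple_val.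
case: (x * y)%g => [[i j] A]; case: x => [[i1 j1] A1]; case: y => [[i2 j2] A2] /=.
by case: ltgtP => h [-> _ ->]; split; try lia; move=> z [Az ?];
  rewrite ?shiftE in Az *; apply: eq_memP Az; lia.
Qed.

Lemma shift_le_antisym (i j : int) (A B : set int) :
  j <= i /\ A `<=` shift (j - i) B -> i <= j /\ B `<=` shift (i - j) A -> A = B.
Proof.
move=> [ji AB] [ij BA]; have e : i = j by lia.
have s0 (C : set int) : shift 0 C = C by apply/funext=> z; rewrite shiftE subr0.
by move: AB BA; rewrite e subrr !s0 => ? ?; apply/seteqP.
Qed.

Lemma greenL_member (x y : T) : greenL x y -> \val x.2 = \val y.2.
Proof.
move=> /greenLP[[->//|[u xu]] [->//|[v yv]]].
have := mulg_left_bound u y; rewrite -xu => /shift_le_antisym; apply.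
by have := mulg_left_bound v x; rewrite -yv.
Qed.

Lemma greenR_member (x y : T) : greenR x y -> \val x.2 = \val y.2.
Proof.
move=> /greenRP[[->//|[u xu]] [->//|[v yv]]].
have := mulg_right_bound y u; rewrite -xu => /shift_le_antisym; apply.
by have := mulg_right_bound x v; rewrite -yv.
Qed.

Lemma ZZfamily_bisimple_singleton : bisimple T -> exists A, F = [set A].
Proof.
(* The base point of the D-class provides a member of [F]. *)
move=> bT; have [a _] := bT; exists (\val a.2); apply/seteqP; split=> A.
  move=> FA; pose b : T := (0, 0, exist (fun A => A \in F) _ (mem_set FA)).
  exact: (bisimple_invariant _ _ _ greenL_member greenR_member bT b a).
by move=> ->; apply: ZZfamily_member.
Qed.

Lemma ZZfamily_singleton_isomorphic :
  (exists A, F = [set A]) -> semigroup_isomorphic T extended_bicyclic.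
Proof.
move=> [A FA]; have AF : A \in F by rewrite FA inE.
have FA1 B : F B -> B = A by rewrite FA.
have FE (B : set_type F) : B = exist (fun A => A \in F) A AF.
  by apply: val_inj; apply: FA1; apply: (ZZfamily_member (0, 0, B)).
pose f (x : T) : extended_bicyclic := x.1.
have fM : {morph f : x y / (x * y)%g}.
  move=> [[i1 j1] A1] [[i2 j2] A2]; rewrite /f /=.
  (* The three cases for the indices are the bicyclic formula with its minimum evaluated. *)
  by case: ltgtP => h; congr (_, _) => /=; lia.
pose fmul := isMultiplicative.Build _ _ f fM.
pose fmorph : {multiplicative T -> extended_bicyclic} := HB.pack f fmul.
exists fmorph; exists (fun u => (u, exist (fun A => A \in F) A AF)) => //.
by move=> [u B] /=; rewrite (FE B).
Qed.

Lemma rees_bisimple_singleton (F0 : F set0) :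
  bisimple (rees_quotient (empty_triples_ideal closedF F0)) -> F = [set set0].
Proof.
set Q := rees_quotient _ => bQ.
pose o : T := (0, 0, exist (fun A => A \in F) _ (mem_set F0)).
have idl := empty_triples_ideal closedF F0.
have piE (x y : T) : empty_triples x -> empty_triples y ->
    (\pi_Q x = \pi_Q y)%qT.
  by move=> x0 y0; apply/eqmodP/asboolP; right.
have mulpi (x y : T) : ((\pi_Q x)%qT * (\pi_Q y)%qT)%g = (\pi_Q (x * y)%g)%qT.
  exact: rees_mul_pi.
have Q0 : forall a : Q, a = (\pi_Q o)%qT.
  apply: (bisimple_zero _ _ _ _ bQ) => q; rewrite -[q]reprK mulpi; apply: piE => //.
    exact: (idl.2 o _ erefl).1.
  exact: (idl.2 o _ erefl).2.
apply/seteqP; split=> [A FA|A ->//].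
pose b : T := (0, 0, exist (fun A => A \in F) _ (mem_set FA)).
(* Either [b] equals [o] or both lie in the ideal; each alternative makes [A] empty. *)
have /eqmodP/asboolP := Q0 (\pi_Q b)%qT.
by move=> [[]|[]].
Qed.

(** The only member of [F] must be [set0], so the collapsed ideal is the whole semigroup. *)
Lemma rees_singleton_trivial (F0 : F set0) :
  (exists A, F = [set A]) ->
  trivial_semigroup (rees_quotient (empty_triples_ideal closedF F0)).
Proof.
move=> [A FA]; set Q := rees_quotient _.
have empty_all (x : T) : empty_triples x.
  have FA1 B : F B -> B = A by rewrite FA.
  by rewrite /empty_triples /= (FA1 _ (ZZfamily_member x)) (FA1 _ F0).
pose o : T := (0, 0, exist (fun A => A \in F) _ (mem_set F0)).
exists (\pi_Q o)%qT; apply/seteqP; split=> // q _ /=.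
by rewrite -[q]reprK; apply/eqmodP/asboolP; right.
Qed.

End Triples.

Theorem mainTheorem8 (F : set (set int))
    (subF : F `<=` [set A | A `<=` omega]) (closedF : omega_closed F) :
  (bisimple (BZfamily closedF) <-> exists A, F = [set A])
  /\ ((exists A, F = [set A]) <->
      (trivial_semigroup (BZfamily closedF) \/
       semigroup_isomorphic (BZfamily closedF) extended_bicyclic)).
Proof.
have i_ii : bisimple (BZfamily closedF) -> exists A, F = [set A].
  rewrite /BZfamily; case: pselect => [F0|_].
    by move=> bQ; exists set0; apply: rees_bisimple_singleton bQ.
  exact: ZZfamily_bisimple_singleton.
have ii_iii : (exists A, F = [set A]) ->
    trivial_semigroup (BZfamily closedF) \/
    semigroup_isomorphic (BZfamily closedF) extended_bicyclic.
  rewrite /BZfamily; case: pselect => [F0|_].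
    by left; apply: rees_singleton_trivial.
  by right; apply: ZZfamily_singleton_isomorphic.
have iii_i : trivial_semigroup (BZfamily closedF) \/
    semigroup_isomorphic (BZfamily closedF) extended_bicyclic ->
    bisimple (BZfamily closedF).
  move=> [/trivial_bisimple//|/bisimple_isomorphic]; apply.
  exact: extended_bicyclic_bisimple.
split; split.
- exact: i_ii.
- by move=> /ii_iii/iii_i.
- exact: ii_iii.
- by move=> /iii_i/i_ii.
Qed.
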